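(* Let $\Gamma$ be a class of topological spaces and assume $\mathtt{OGD}^{\mathbb{N}}(\Gamma)$. Suppose that $D$ is a countable discrete set of cardinality at least two, $X$ is a metric space in $\Gamma$, and $H$ is a $D$-dimensional dihypergraph on $X$. Then exactly one of the following holds: (1) there is a $\mathbf{\Delta}^0_2$-measurable $\aleph_0$-coloring of $H$; (2) there is a continuous homomorphism from $\mathbb{H}_{(D\times\mathbb{N})^{\mathbb{N}},\infty}$ to $H$.
   Context: Base theory: $\mathsf{ZF}+\mathsf{DC}$. A $D$-dimensional dihypergraph on $X$ is a subset of $X^D$ containing no constant sequence (no openness is assumed of $H$). A homomorphism from $R\subseteq W^{D}$ to $S\subseteq Z^{D}$ is a map $\pi\colon W\to Z$ sending, coordinatewise, elements of $R$ to elements of $S$. An $\aleph_0$-coloring of $H$ is a map from $X$ to a set of cardinality $\aleph_0$ that is non-constant along every element of $H$. A set is $\mathbf{\Delta}^0_2$ if it is both $F_\sigma$ and $G_\delta$; a function (here into a discrete countable set) is $\mathbf{\Delta}^0_2$-measurable if the preimage of every open set is $\mathbf{\Delta}^0_2$. $\mathbb{N}_*=\mathbb{N}\cup\{\infty\}$ is the one-point compactification of $\mathbb{N}$, and $D\times\mathbb{N}_*$ has the product topology ($D$ discrete). For a topological space $X'$ and a discrete set $E\subseteq X'$, $\mathrm{Ext}_{X'}(E^{\mathbb{N}})=E^{\mathbb{N}}\cup\{t\cdot(x) : t\in E^{<\mathbb{N}},\ x\in X'\setminus E\}$, with the topology generated by the sets $\mathcal{N}_{t,U}=\{b\in\mathrm{Ext}_{X'}(E^{\mathbb{N}})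 : t\sqsubset b\text{ and }b(|t|)\in U\}$ for $t\in E^{<\mathbb{N}}$ and $U\subseteq X'$ open ($E^{<\mathbb N}$ denotes finite sequences, $\sqsubset$ strict extension, $|t|$ length, $t\cdot(x)$ is $t$ followed by the single entry $x$). $\mathbb{H}_{(D\times\mathbb{N})^{\mathbb{N}},\infty}$ is the $D$-dimensional dihypergraph on $\mathrm{Ext}_{D\times\mathbb{N}_*}((D\times\mathbb{N})^{\mathbb{N}})$ consisting of all sequences $(t\cdot((d,\infty)))_{d\in D}$ with $t\in(D\times\mathbb{N})^{<\mathbb{N}}$. Definition of $\mathtt{OGD}^{\mathbb{N}}(\Gamma)$: for every $Z\in\Gamma$ and every box-open $\mathbb{N}$-dimensional dihypergraph $G$ on $Z$, either $G$ has chromatic number at most $\aleph_0$ or there is a continuous homomorphism from $\mathbb{H}_{\mathbb{N}^{\mathbb{N}}}$ to $G$. Here an $\mathbb{N}$-dimensional dihypergraph on $Z$ is a subset of $Z^{\mathbb{N}}$ containing no constant sequence; a homomorphism from $R\subseteq W^{\mathbb{N}}$ to $S\subseteq Z^{\mathbb{N}}$ is a map $\pi\colon W\to Z$ sending, coordinatewise, elements of $R$ to elements of $S$; $G$ is box-open if it is open in the topology on $Z^{\mathbb{N}}$ generated by the sets $\prod_n U_n$ with all $U_n\subseteq Z$ open; the chromatic number of $G$ is the least cardinal $\kappa$ for which there is a map from $Z$ to a set of cardinality $\kappa$ that is non-constant along every element of $G$; and $\mathbb{H}_{\mathbb{N}^{\mathbb{N}}}=\bigcup_{t\in\mathbb{N}^{<\mathbb{N}}}\prod_{n\in\mathbb{N}}\mathcal{N}_{t\cdot(n)}$,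 where $\mathcal{N}_s=\{b\in\mathbb{N}^{\mathbb{N}} : s\sqsubseteq b\}$. *)

(* Defs.v *)
From HB Require Import structures.
From mathcomp Require Import all_boot all_order all_algebra.
From mathcomp Require Import all_classical all_reals all_analysis.
From mathcomp Require Import borel_hierarchy.

Set Implicit Arguments.
Unset Strict Implicit.
Unset Printing Implicit Defensive.

Local Open Scope classical_set_scope.

(* A [D]-dimensional dihypergraph on [X] is represented by its set of edges,
   sequences being functions [D -> X]. *)
Definition is_dihypergraph (D X : Type) (H : set (D -> X)) : Prop :=
  forall x : X, ~ H (fun _ => x).

Definition is_homomorphism (D W Z : Type) (R : set (D -> W))
    (S : set (D -> Z)) (f : W -> Z) : Prop :=
  forall r, R r -> S (fun d => f (r d)).

Definition is_coloring (D X K : Type) (H : set (D -> X)) (c : X -> K) : Prop :=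
  forall h, H h -> ~ exists k, forall d, c (h d) = k.

Definition chromatic_le_aleph0 (D X : Type) (H : set (D -> X)) : Prop :=
  exists (K : Type) (c : X -> K), countable [set: K] /\ is_coloring H c.

Definition delta02 (X : topologicalType) (A : set X) : Prop :=
  Fsigma A /\ Gdelta A.

Definition delta02_measurable (X Y : topologicalType) (f : X -> Y) : Prop :=
  forall U : set Y, open U -> delta02 (f @^-1` U).

Definition has_delta02_aleph0_coloring (D : Type) (X : topologicalType)
    (H : set (D -> X)) : Prop :=
  exists (K : discreteTopologicalType) (c : X -> K),
    [/\ ([set: K] #= [set: nat])%card, is_coloring H c & delta02_measurable c].

Definition has_continuous_homomorphism (D : Type) (W Z : topologicalType)
    (R : set (D -> W)) (S : set (D -> Z)) : Prop :=
  exists2 f : W -> Z, continuous f & is_homomorphism R S f.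

Definition box_topology (I Z : Type) : Type := I -> Z.

Section box_topology.
Context (I : Type) (Z : topologicalType).

Definition box (U : I -> set Z) : set (box_topology I Z) :=
  [set g | forall i, U i (g i)].

Definition open_boxes : set (set (box_topology I Z)) :=
  [set B | exists2 U : I -> set Z, (forall i, open (U i)) & B = box U].

HB.instance Definition _ := gen_eqMixin (box_topology I Z).
HB.instance Definition _ := gen_choiceMixin (box_topology I Z).
HB.instance Definition _ :=
  @isSubBaseTopological.Build (box_topology I Z)
    (set (box_topology I Z)) open_boxes id.

End box_topology.

Definition box_open (I : Type) (Z : topologicalType) (G : set (I -> Z)) : Prop :=
  open (G : set (box_topology I Z)).

Definition baire_space : topologicalType := prod_topology (fun _ : nat => nat).

Definition cylinder (s : seq nat) : set baire_space :=
  [set b | forall i, (i < size s)%N -> b i = nth 0%N s i].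

Definition H_baire : set (nat -> baire_space) :=
  \bigcup_(t in [set: seq nat])
    [set h | forall n, cylinder (rcons t n) (h n)].

Definition OGDN (Gamma : topologicalType -> Prop) : Prop :=
  forall Z : topologicalType, Gamma Z ->
  forall G : set (nat -> Z), is_dihypergraph G -> box_open G ->
    chromatic_le_aleph0 G \/ has_continuous_homomorphism H_baire G.

(* [ExtSeq b] is the infinite sequence [b], and [ExtFin t x] is the finite
   sequence consisting of [t] followed by the single entry [x] outside [E].
   The construction does not require [E] to be discrete. *)
Inductive Ext (X : Type) (E : set X) : Type :=
  | ExtSeq of nat -> E
  | ExtFin of seq E & ~` E.

Arguments ExtSeq {X} E _.
Arguments ExtFin {X} E _ _.

Section Ext.
Context (X : topologicalType) (E : set X).

(* The [n]-th entry of a (finite or infinite) sequence, if there is one. *)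
Definition ext_entry (b : Ext E) (n : nat) : option X :=
  match b with
  | ExtSeq f => Some (\val (f n))
  | ExtFin t x => onth (rcons (map \val t) (\val x)) n
  end.

(* Strictness of the extension is the existence of the entry of index
   [size t]. *)
Definition ext_nbhs (t : seq E) (U : set X) : set (Ext E) :=
  [set b | (forall i, (i < size t)%N -> ext_entry b i = onth (map \val t) i) /\
           exists2 x, ext_entry b (size t) = Some x & U x].

Definition ext_subbase : set (set (Ext E)) :=
  [set B | exists (t : seq E) (U : set X), open U /\ B = ext_nbhs t U].

HB.instance Definition _ := gen_eqMixin (Ext E).
HB.instance Definition _ := gen_choiceMixin (Ext E).
HB.instance Definition _ :=
  @isSubBaseTopological.Build (Ext E) (set (Ext E)) ext_subbase id.

End Ext.

Definition natoo : topologicalType := one_point_compactification nat.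

Section H_infty.
Context (D : discreteTopologicalType).

Definition DxN : set (D * natoo) :=
  [set p | exists n : nat, p.2 = Some n].

Lemma infty_notin (d : D) : ((d, None) : D * natoo) \in ~` DxN.
Proof. by apply/mem_set => -[]. Qed.

Definition infty_pt (d : D) : ~` DxN := exist _ (d, None) (infty_notin d).

Definition ExtDN : topologicalType := Ext DxN.

Definition H_infty : set (D -> ExtDN) :=
  [set h | exists t : seq DxN, forall d, h d = ExtFin DxN t (infty_pt d)].

End H_infty.

(* Main.v *)
(* [H] has a Delta^0_2-measurable coloring in
   countably many colors iff [X] is covered by countably many sets whose closures
   contain no edge of [H]. Let [G] consist of the sequences [g], indexed by [D]
   x N, such that [g (d, n)] is within [1 / (n + 1)] of [h d] for some edge [h]
   of [H]. It is box-open, and a set independent for [G] has a closure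
   independent for [H]. So either [H] has a coloring, or OGD gives a continuous
   [f] on [(D x N)^N] whose values on sequences extending [t . (d, n)] converge,
   as [n] grows, to the [d]-th vertex of an edge of [H]; this limit does not
   depend on the choice of the extensions, and sending [t . (d, oo)] to it
   extends [f] to the required homomorphism. The two alternatives exclude each
   other because, by the Baire category theorem, some color class of the pulled
   back coloring contains a closed set which contains all infinite extensions of
   some [t], hence also all the [t . (d, oo)]. *)
Require Import Defs.
From mathcomp Require Import all_boot all_order all_algebra.
From mathcomp Require Import all_classical all_reals all_analysis.
From mathcomp Require Import borel_hierarchy.

Local Open Scope classical_set_scope.

Import Order.TTheory GRing.Theory Num.Theory.

(** * Initial segments of sequences and the Baire category theorem *)

Definition agree {A : Type} (b : nat -> A) (n : nat) : set (nat -> A) :=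
  [set b' | forall i, (i < n)%N -> b' i = b i].

Lemma mkseq_agree {A : Type} (b b' : nat -> A) n :
  mkseq b' n = mkseq b n <-> agree b n b'.
Proof.
split=> [e i lt_in|e].
  by move: (congr1 (fun s => nth (b i) s i) e); rewrite !nth_mkseq.
by apply/eq_in_map => i; rewrite mem_iota => /andP[_]; exact: e.
Qed.

Lemma mkseq_nth_size {A : Type} (a : A) (s : seq A) (k : nat) :
  (k <= size s)%N -> mkseq (nth a s) k = take k s.
Proof.
move=> le_k; apply: (@eq_from_nth _ a); rewrite size_mkseq ?size_takel//.
by move=> i lt_i; rewrite nth_mkseq// nth_take.
Qed.

(** The neighbourhood filter of [b] for discrete [A], stated without a topology on [A]. *)
Definition agree_filter {A : Type} (b : nat -> A) : set_system (nat -> A) :=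
  filter_from setT (agree b).

Global Instance agree_filter_filter {A : Type} (b : nat -> A) :
  Filter (agree_filter b).
Proof.
apply: filter_from_filter; first by exists 0%N.
move=> m n _ _; exists (maxn m n) => // b' bb'.
by split=> i lt_i; apply: bb'; rewrite leq_max lt_i ?orbT.
Qed.

Lemma agree_filter_cvg (b : baire_space) : agree_filter b --> b.
Proof.
have FF := agree_filter_filter b.
apply/cvg_sup => i U [V [[W oW <-] Wb]] /filterS; apply.
by exists i.+1 => // b' /(_ i (ltnSn i)) /= ->.
Qed.

(** The first hypothesis says that each [Q n] is closed. If no [Q n] contained a cylinder, nested
    cylinders avoiding [Q 0], [Q 1], ... in turn would shrink to a point outside every [Q n]. *)
Lemma baire_category {A : Type} (a : A) (Q : nat -> set (nat -> A)) :
  (forall n b, ~ Q n b -> exists m, agree b m `<=` ~` Q n) ->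
  (forall b, exists n, Q n b) -> exists n b m, agree b m `<=` Q n.
Proof.
move=> Qclosed Qcover; apply: contrapT => noQ.
have step n (bm : (nat -> A) * nat) : exists bm' : (nat -> A) * nat,
    [/\ (bm.2 < bm'.2)%N, agree bm.1 bm.2 bm'.1 & agree bm'.1 bm'.2 `<=` ~` Q n].
  have /existsNP[b' /not_implyP[bb' /Qclosed[m Qm]]] :
      ~ agree bm.1 bm.2 `<=` Q n.
    by move=> Qn; apply: noQ; exists n, bm.1, bm.2.
  (* Strictly longer cylinders at each stage make the limit defined at every coordinate. *)
  exists (b', maxn m bm.2.+1); split=> //=.
    by rewrite leq_max ltnSn orbT.
  by move=> x xb'; apply: Qm => i lt_i; apply: xb'; rewrite leq_max lt_i.
pose next n bm := projT1 (cid (step n bm)).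
pose x := fix x n := if n is k.+1 then next k (x k) else (fun=> a, 0%N).
have xS n : [/\ ((x n).2 < (x n.+1).2)%N, agree (x n).1 (x n).2 (x n.+1).1 &
    agree (x n.+1).1 (x n.+1).2 `<=` ~` Q n].
  by rewrite /= /next; case: cid.
have le_x n : (n <= (x n).2)%N.
  by elim: n => // n IH; apply: leq_ltn_trans IH _; have [] := xS n.
have mono m n : (m <= n)%N ->
    ((x m).2 <= (x n).2)%N /\ agree (x m).1 (x m).2 (x n).1.
  elim: n => [|n IH]; first by rewrite leqn0 => /eqP ->.
  rewrite leq_eqVlt => /predU1P[->//|/IH[le_mn agr]].
  have [lt_n agrn _] := xS n; split; first exact: leq_trans le_mn (ltnW lt_n).
  by move=> i lt_i; rewrite agrn ?agr// (leq_trans lt_i).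
(* Stage [i.+1] fixes at least [i.+1] entries, so entry [i] no longer changes after it. *)
pose b i := (x i.+1).1 i.
have bx n : agree (x n).1 (x n).2 b.
  move=> i lt_i; rewrite /b; have [le_n|lt_n] := leqP n i.+1.
    by have [_ ->] := mono _ _ le_n.
  by have [_ ->//] := mono _ _ (ltnW lt_n); apply: le_x.
have [n Qnb] := Qcover b.
by have [_ _ /(_ _ (bx n.+1))] := xS n.
Qed.

(** * F-sigma sets, and colorings from closed covers of a metric space *)

Lemma Fsigma_bigcup {T : topologicalType} (S : nat -> set T) :
  (forall n, Fsigma (S n)) -> Fsigma (\bigcup_n S n).
Proof.
move=> FS.
pose F n := projT1 (cid2 (FS n)).
have cF n i : closed (F n i) by rewrite /F; case: cid2.
have SF n : S n = \bigcup_i F n i by rewrite /F; case: cid2.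
exists (fun k => if unpickle k is Some ni then F ni.1 ni.2 else set0).
  by move=> k; case: unpickle => [ni|]; [exact: cF|exact: closed0].
apply/seteqP; split=> [x [n _]|x [k _]].
  rewrite SF => -[i _ Fx].
  by exists (pickle (n, i)) => //; rewrite pickleK.
case: unpickle => // -[n i] /= Fx.
by exists n => //; rewrite SF; exists i.
Qed.

Lemma Fsigma_closedI {T : topologicalType} (C S : set T) :
  closed C -> Fsigma S -> Fsigma (C `&` S).
Proof.
move=> cC [F cF ->]; exists (fun i => C `&` F i).
  by move=> i; exact: closedI.
by rewrite setI_bigcupr.
Qed.

Lemma FsigmaC {T : topologicalType} (S : set T) : Fsigma (~` S) -> Gdelta S.
Proof.
move=> [F cF SF]; exists (fun i => ~` F i).
  by move=> i; exact: closed_openC.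
by rewrite -setC_bigcup -SF setCK.
Qed.

Section metric.
Context {R : realType} {X : metricType R}.
Local Open Scope ring_scope.

Lemma open_mdist_lt (x : X) (e : R) : open [set y | mdist x y < e].
Proof.
rewrite openE => y /= xye; apply/nbhs_ballP.
exists (e - mdist x y) => /=; first by rewrite subr_gt0.
move=> z; rewrite ballEmdist /= ltrBrDl.
exact: le_lt_trans (metric_triangle _ _ _).
Qed.

Lemma natSinv_lt (e : R) : 0 < e -> exists n, n.+1%:R^-1 < e.
Proof.
move=> e0; have [N _ /(_ N (leqnn N))] := near_infty_natSinv_lt (PosNum e0).
by exists N.
Qed.

Lemma le_natSinv (m n : nat) : (m <= n)%N -> n.+1%:R^-1 <= m.+1%:R^-1 :> R.
Proof. by move=> le_mn; rewrite lef_pV2 ?posrE ?ltr0n// ler_nat. Qed.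

(** [O] is exhausted by the closed sets of points at distance at least [1 / (n + 1)] from every
    point of its complement. *)
Lemma open_Fsigma (O : set X) : open O -> Fsigma O.
Proof.
move=> oO.
exists (fun n => ~` \bigcup_(y in ~` O) [set x | mdist y x < n.+1%:R^-1]).
  by move=> n; apply: open_closedC; apply: bigcup_open => y _; exact: open_mdist_lt.
apply/seteqP; split=> [x Ox|x [n _ xn]].
  have /nbhs_ballP[e /= e0] : nbhs x O by exact: open_nbhs_nbhs.
  rewrite ballEmdist => eO; have [n ne] := natSinv_lt _ e0.
  exists n => // -[y nOy] /= yx; apply: nOy; apply: eO => /=.
  by rewrite metric_sym (lt_trans yx).
apply: contrapT => nOx; apply: xn; exists x => //=.
by rewrite mdistxx invr_gt0 ltr0n.
Qed.

(** Color [x] by the least [n] with [F n x]. A color class is [F n] minus finitely many closed sets,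
    hence F-sigma, and so is any union of classes; applied to the complementary set of colors, this
    also gives G-delta. *)
Lemma closed_cover_coloring (D : Type) (H : set (D -> X)) (F : nat -> set X) :
  (forall n, closed (F n)) -> (forall x, exists n, F n x) ->
  (forall n h, H h -> ~ forall d, F n (h d)) ->
  has_delta02_aleph0_coloring H.
Proof.
move=> cF Fcover FH.
pose isleast x n := F n x /\ forall m, (m < n)%N -> ~ F m x.
have exleast x : exists n, isleast x n.
  have exF : exists n, `[< F n x >].
    by have [n Fn] := Fcover x; exists n; apply/asboolP.
  case: (ex_minnP exF) => n /asboolP Fn minF; exists n; split=> // m lt_mn /asboolP.
  by move=> /minF; rewrite leqNgt lt_mn.
have [c cP] := choice exleast.
have FsP (U : set nat) : Fsigma (c @^-1` U).
  have -> : c @^-1` U = \bigcup_n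
     (if n \in U then F n `&` ~` \bigcup_(m in `I_n) F m else set0).
    apply/seteqP; split=> [x /= Ux|x [n _]].
      exists (c x) => //; rewrite mem_set//; have [Fx Fm] := cP x.
      by split=> // -[m /= /Fm].
    case: ifPn => // /set_mem Un [Fn nF] /=; suff -> : c x = n by [].
    have [Fc Fm] := cP x; case: (ltngtP (c x) n) => // lt_n.
      by case: nF; exists (c x).
    by case: (Fm _ lt_n).
  apply: Fsigma_bigcup => n; case: ifPn => _; last exact/closed_Fsigma/closed0.
  apply: Fsigma_closedI => //; apply: open_Fsigma; rewrite openC.
  apply: closed_bigcup => //; exact: finite_II.
exists (nat : discreteTopologicalType), c; split.
- exact: card_eqxx.
- move=> h Hh [k ck]; apply: (FH k h Hh) => d.
  by rewrite -(ck d); have [] := cP (h d).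
- by move=> U _; split=> //; apply: FsigmaC; exact: FsP (~` U).
Qed.

End metric.

(** * Convergence in the space of infinite and finite sequences *)

Lemma open_ext_nbhs {X : topologicalType} {E : set X} (t : seq E) (U : set X) :
  open U -> open (ext_nbhs t U).
Proof.
move=> oU; exists [set ext_nbhs t U]; last by rewrite bigcup_set1.
by move=> _ ->; apply: (finI_from1 id); exists t, U.
Qed.

Lemma ext_cvg {X : topologicalType} {E : set X} (F : set_system (Ext E))
    (p : Ext E) : Filter F ->
  (forall t U, open U -> ext_nbhs t U p -> F (ext_nbhs t U)) -> F --> p.
Proof.
move=> FF Fnbhs A; rewrite /= nbhsE => -[_ [[D' D'fin <-] [B D'B Bp]] subA].
apply: (filterS subA); apply: (@filterS _ F _ B); first by move=> y By; exists B.
have [J Jsub BJ] := D'fin _ D'B; move: Bp; rewrite -BJ => Jp.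
apply: filter_bigI => S JS; have /= := Jsub _ JS; rewrite inE => -[t [U [oU SU]]].
by rewrite SU; apply: Fnbhs => //; rewrite -SU; exact: Jp.
Qed.

Lemma onth_mkseq {A : Type} (b : nat -> A) (n i : nat) :
  (i < n)%N -> onth (mkseq b n) i = Some (b i).
Proof. by move=> lt_i; rewrite onthE (nth_map (b 0%N)) ?size_mkseq ?nth_mkseq. Qed.

Lemma ext_nbhs_seq {X : topologicalType} {E : set X} (t : seq E) (U : set X)
    (b : nat -> E) :
  ext_nbhs t U (ExtSeq E b) <-> mkseq b (size t) = t /\ U (val (b (size t))).
Proof.
split=> -[tb].
  move=> [x [<-] Ux]; split=> //.
  apply: eq_from_onth_le => i; rewrite size_mkseq maxnn => lt_i.
  have := tb i lt_i; rewrite onth_mkseq//= onth_map.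
  case: (onth t i) => //= y [] /val_inj -> //.
move=> Ub; split; last by exists (val (b (size t))).
by move=> i lt_i; rewrite -tb /= onth_map onth_mkseq.
Qed.

Lemma ext_entry_fin_lt {X : topologicalType} {E : set X} (s : seq E)
    (x : ~` E) (b : nat -> E) (i : nat) :
  mkseq b (size s) = s -> (i < size s)%N ->
  ext_entry (ExtFin E s x) i = ext_entry (ExtSeq E b) i.
Proof.
move=> bs lt_i; rewrite /= -cats1 onth_cat size_map lt_i.
by rewrite -bs onth_map onth_mkseq.
Qed.

Lemma ext_entry_fin_size {X : topologicalType} {E : set X} (s : seq E)
    (x : ~` E) : ext_entry (ExtFin E s x) (size s) = Some (val x).
Proof. by rewrite /= -cats1 onth_cat size_map ltnn subnn. Qed.

(** Either the constraint [U] falls on the last entry [x], or the set is decided by the entries of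
    [s] and so contains every infinite extension of [s]. *)
Lemma ext_nbhs_fin {X : topologicalType} {E : set X} (t s : seq E) (U : set X)
    (x : ~` E) (b : nat -> E) :
  mkseq b (size s) = s -> ext_nbhs t U (ExtFin E s x) ->
  (s = t /\ U (val x)) \/ ((size t < size s)%N /\ ext_nbhs t U (ExtSeq E b)).
Proof.
move=> bs [ts [y]]; have [lt_ts|lt_st|e] := ltngtP (size t) (size s).
- rewrite (ext_entry_fin_lt _ _ _ _ bs)// => by_ Uy; right; split=> //.
  split=> [i lt_i|]; last by exists y.
  by rewrite -ts// (ext_entry_fin_lt _ _ _ _ bs)// (ltn_trans lt_i).
- by rewrite /= onth_default// size_rcons size_map.
- rewrite e ext_entry_fin_size => -[<-] Ux; left; split=> //.
  suff /ext_nbhs_seq[<- _] : ext_nbhs t setT (ExtSeq E b) by rewrite e bs.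
  split=> [i lt_i|]; last by exists (val (b (size t))).
  by rewrite -ts// (ext_entry_fin_lt _ _ _ _ bs)// -e.
Qed.

Lemma cvg_agree_seq {X : topologicalType} {E : set X} (b : nat -> E) :
  (ExtSeq E) @ agree_filter b --> ExtSeq E b.
Proof.
apply: ext_cvg => t U oU /ext_nbhs_seq[tb Ub].
exists (size t).+1 => // b' bb' /=; apply/ext_nbhs_seq; split.
  by rewrite -{2}tb; apply/mkseq_agree => i lt_i; apply: bb'; rewrite ltnS ltnW.
by rewrite bb'.
Qed.

Lemma cvg_seq_fin {X : topologicalType} {E : set X} (t : seq E) (x : ~` E)
    (b : nat -> nat -> E) :
  (forall n, mkseq (b n) (size t) = t) ->
  (fun n => val (b n (size t))) @ \oo --> val x ->
  (fun n => ExtSeq E (b n)) @ \oo --> ExtFin E t x.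
Proof.
move=> bt bx; apply: ext_cvg => s U oU stx.
have [[est Ux]|[lt_st _]] := ext_nbhs_fin _ _ _ _ _ (bt 0%N) stx; last first.
  exists 0%N => // n _.
  by have [[ts]|[]//] := ext_nbhs_fin _ _ _ _ _ (bt n) stx; rewrite ts ltnn in lt_st.
have : \forall n \near \oo, U (val (b n (size t))).
  by apply: bx; exact: open_nbhs_nbhs.
by move=> [N _ UN]; exists N => // n /UN Un; apply/ext_nbhs_seq; rewrite -est.
Qed.

(** * Points at infinity, and incompatibility of the two alternatives *)

Section H_infty_theory.
Context {D : discreteTopologicalType}.

Lemma dn_in (d : D) (n : nat) : ((d, Some n) : D * natoo) \in DxN (D:=D).
Proof. by apply/mem_set; exists n. Qed.

Definition dn (d : D) (n : nat) : DxN (D:=D) := exist _ (d, Some n) (dn_in d n).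

Lemma dnP (s : DxN (D:=D)) : exists d n, s = dn d n.
Proof.
case: s => -[d x] xE; have [n /= xn] := set_mem xE.
by exists d, n; apply: val_inj; rewrite /= -xn.
Qed.

Lemma infty_ptP (x : ~` DxN (D:=D)) : exists d, x = infty_pt d.
Proof.
case: x => -[d [n|]] xE; last by exists d; apply: val_inj.
by case: (set_mem xE); exists n.
Qed.

(** Basic neighbourhoods of [(d, oo)]: the point at infinity is [None], for which the second
    condition is vacuous. *)
Definition tail (d : D) (k : nat) : set (D * natoo) :=
  [set p | p.1 = d /\ forall n, p.2 = Some n -> (k <= n)%N].

Lemma tail_infty (d : D) (k : nat) : tail d k (val (infty_pt d)).
Proof. by []. Qed.

Lemma open_tail (d : D) (k : nat) : open (tail d k).
Proof.
rewrite openE => -[e x] [/= -> {e} xk].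
exists ([set d], [set y : natoo | forall n, y = Some n -> (k <= n)%N]); last first.
  by move=> [e' x'] /= [-> x'k].
split=> /=.
  by rewrite nbhs_principalE; apply/principal_filterP.
case: x xk => [m|] xk.
  rewrite /nbhs /= nbhs_principalE; apply/principal_filterP => /= n [<-].
  exact: xk.
(* A neighbourhood of infinity is given by its closed compact complement, here the numbers below
   [k]. *)
exists `I_k.
  split; first exact: (finite_compact (finite_II k)).
  exact: discrete_closed.
by move=> _ [[m /= /negP nm <-] n [<-]|-> //]; rewrite leqNgt.
Qed.

(** Otherwise the tails of [C] would have a cluster point [p], but the neighbourhood [{p}] misses
    the tail from [p.+1] on. It follows that neighbourhoods of infinity contain all large
    numbers. *)
Lemma compact_nat_bounded (C : set nat) :
  compact C -> exists N, forall n, C n -> (n < N)%N.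
Proof.
move=> cC; apply: contrapT => unbounded.
pose B N := C `&` [set n | (N <= n)%N].
have FF : ProperFilter (filter_from setT B).
  apply: filter_from_proper; first apply: filter_from_filter.
  - by exists 0%N.
  - move=> m n _ _; exists (maxn m n) => // k [Ck].
    by rewrite /= geq_max => /andP[mk nk].
  move=> N _; apply: contrapT => B0; apply: unbounded; exists N => n Cn.
  by rewrite ltnNge; apply/negP => le_n; apply: B0; exists n.
have [|p [_ clp]] := cC _ FF; first by exists 0%N => // n [].
have np : nbhs p [set p] by rewrite nbhs_principalE; apply/principal_filterP.
have FB : filter_from setT B (B p.+1) by exists p.+1.
by have [n [[_ /= lt_pn] /= np']] := clp _ _ FB np; rewrite np' ltnn in lt_pn.
Qed.

Lemma cvg_dn (d : D) : (fun n => val (dn d n)) @ \oo --> val (infty_pt d).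
Proof.
move=> A [[P Q] [/= Pd [C [cC _] CQ]] PQA].
have [N CN] := compact_nat_bounded C cC.
exists N => // n /= le_n; apply: PQA; split; first exact: nbhs_singleton.
by apply: CQ; left; exists n => // /CN; rewrite ltnNge le_n.
Qed.

Lemma coloring_homomorphism_exclusive (X : topologicalType) (H : set (D -> X)) (d0 : D) :
  ~ (has_delta02_aleph0_coloring H /\
     has_continuous_homomorphism (H_infty (D:=D)) H).
Proof.
move=> [[K [c [cardK cH cdelta]]] [f cf fH]].
have [e einj] : exists e : K -> nat, injective e.
  have /countable_injP[e einj] : countable [set: K].
    by rewrite (eq_countable cardK).
  by exists e => x y; apply: einj; rewrite inE.
have /choice[F FP] : forall k, exists F : nat -> set X,
    (forall i, closed (F i)) /\ c @^-1` [set k] = \bigcup_i F i.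
  move=> k; have [[F cF FE] _] := cdelta [set k] (discrete_open _).
  by exists F.
(* [n] codes a color [k] and an index [i] of a closed piece of its class; a number coding no such
   pair gives the empty set. *)
pose Q n := [set b : nat -> DxN (D:=D) | exists k i,
   n = pickle (e k, i) /\ F k i (f (ExtSeq _ b))].
have [||n [b [m Qn]]] := baire_category (dn d0 0) Q.
- move=> n b nQ; have [[k [i ni]]|none] := pselect (exists k (i : nat), n = pickle (e k, i)).
    have nFk : ~ F k i (f (ExtSeq _ b)) by move=> Fb; apply: nQ; exists k, i.
    have [cF _] := FP k.
    have := cvg_agree_seq b.
    have nb : nbhs (ExtSeq _ b : ExtDN D) (f @^-1` (~` F k i)).
      by apply: cf; apply: open_nbhs_nbhs; split=> //; apply: closed_openC.
    move=> /(_ _ nb) [j _ jP]; exists j => b' /jP /= nF [k' [i' [ni' F']]].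
    have := pcan_inj pickleK (etrans (esym ni) ni') => -[/einj ek ei].
    by apply: nF; rewrite ek ei.
  by exists 0%N => b' _ [k [i [ni _]]]; apply: none; exists k, i.
- move=> b; have [_ Fc] := FP (c (f (ExtSeq _ b))).
  have : (c @^-1` [set c (f (ExtSeq _ b))]) (f (ExtSeq _ b)) by [].
  rewrite Fc => -[i _ Fi].
  by exists (pickle (e (c (f (ExtSeq _ b))), i)), (c (f (ExtSeq _ b))), i.
(* [b] lies in its own cylinder, so [n] does code a pair. *)
have [k [i [nki _]]] := Qn b (fun _ _ => erefl).
have [cF Fc] := FP k.
pose t := mkseq b m.
apply: (cH (fun d => f (ExtFin _ t (infty_pt d)))); first by apply: fH; exists t.
exists k => d.
suff : F k i (f (ExtFin _ t (infty_pt d))).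
  move=> Fi; have : (\bigcup_i F k i) (f (ExtFin _ t (infty_pt d))) by exists i.
  by rewrite -Fc.
(* Infinite extensions of [t . (d, j)], padded by a default letter; they stay in the cylinder and
   tend to [t . (d, oo)], so the closed piece keeps the limit. *)
pose bn j := nth (dn d0 0) (rcons t (dn d j)).
have bnt j : mkseq (bn j) (size t) = t.
  by rewrite mkseq_nth_size ?size_rcons// -cats1 take_size_cat.
have bnd j : bn j (size t) = dn d j by rewrite /bn nth_rcons ltnn eqxx.
apply: (@closed_cvg _ _ \oo _ (fun j => f (ExtSeq _ (bn j))) _ (cF i)).
  exists 0%N => // j _.
  have /Qn[k' [i' [ni' F']]] : agree b m (bn j).
    by apply/mkseq_agree; have := bnt j; rewrite size_mkseq.
  have := pcan_inj pickleK (etrans (esym nki) ni') => -[/einj ek ei].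
  by rewrite ek ei.
apply: (@cvg_comp _ _ _ (fun j => ExtSeq _ (bn j) : ExtDN D) f _ _ _ _ (cf _)).
apply: (cvg_seq_fin t (infty_pt d) bn) => //.
by under eq_fun do rewrite bnd; exact: cvg_dn.
Qed.

End H_infty_theory.

(** * Extending maps to the points at infinity, and the approximating dihypergraph *)

Section homomorphism.
Context {D : discreteTopologicalType} {R : realType} {X : metricType R}.
Variable H : set (D -> X).
Local Open Scope ring_scope.
Local Notation S := (DxN (D:=D)).

(** The extension sends [t . (d, oo)] to the vertex [h t d]. Infinite sequences approximate every
    point together with its value, so continuity can be tested on them alone. *)
Lemma homomorphism_extension (d0 : D) (f : (nat -> S) -> X) :
  (forall b (e : R), 0 < e -> exists n, forall b', agree b n b' ->
     mdist (f b) (f b') < e) ->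
  (forall t : seq S, exists h, H h /\ forall d n b,
     mkseq b (size t).+1 = rcons t (dn d n) ->
     mdist (f b) (h d) < n.+1%:R^-1) ->
  has_continuous_homomorphism (H_infty (D:=D)) H.
Proof.
move=> fcont /choice[h hP].
pose F (p : ExtDN D) : X :=
  match p with ExtSeq b => f b | ExtFin t x => h t (\val x).1 end.
have approx (O : set (ExtDN D)) p (e : R) : open O -> O p -> 0 < e ->
    exists b, O (ExtSeq _ b) /\ mdist (f b) (F p) < e.
  move=> oO Op e0; case: p Op => [b|t x] Op.
    by exists b; rewrite mdistxx.
  have [d xd] := infty_ptP x; subst x.
  pose b n := nth (dn d0 0) (rcons t (dn d n)).
  have bt n : mkseq (b n) (size t) = t.
    by rewrite mkseq_nth_size ?size_rcons// -cats1 take_size_cat.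
  have bd n : b n (size t) = dn d n by rewrite /b nth_rcons ltnn eqxx.
  have bx : (fun n => \val (b n (size t))) @ \oo --> \val (infty_pt d).
    by under eq_fun do rewrite bd; exact: cvg_dn.
  have [N _ NO] := cvg_seq_fin t _ b bt bx _ (open_nbhs_nbhs (conj oO Op)).
  have [m me] := natSinv_lt _ e0.
  exists (b (maxn N m)); split; first by apply: NO; rewrite /= leq_maxl.
  have [_ htP] := hP t; apply: lt_trans me.
  apply: lt_le_trans (le_natSinv _ _ (leq_maxr N m)).
  by apply: htP; rewrite mkseqS bt bd.
(* The other half of [e] pays for replacing a point [q] of [O] by an infinite sequence in [O]. *)
have local (O : set (ExtDN D)) p (e : R) : open O -> O p -> 0 < e ->
    (forall b, O (ExtSeq _ b) -> mdist (f b) (F p) < e / 2) ->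
    nbhs p (F @^-1` ball (F p) e).
  move=> oO Op e0 Oe; rewrite nbhsE; exists O => //.
  move=> q Oq /=; rewrite ballEmdist /=.
  have e20 : 0 < e / 2 by rewrite divr_gt0.
  have [b [Ob bq]] := approx O q (e / 2) oO Oq e20.
  apply: le_lt_trans (metric_triangle _ (f b) _) _.
  by rewrite [e]splitr ltrD// metric_sym; exact: Oe.
exists F.
  move=> p A /nbhs_ballP[e /= e0 eA].
  suff : nbhs p (F @^-1` ball (F p) e) by apply: filterS => q /eA.
  have e20 : 0 < e / 2 by rewrite divr_gt0.
  case: p {eA A} => [b|t x].
    have [n nP] := fcont b _ e20.
    apply: (local (ext_nbhs (mkseq b n) setT)) => //.
    - by apply: open_ext_nbhs; exact: openT.
    - by apply/ext_nbhs_seq; rewrite size_mkseq.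
    - move=> b' /ext_nbhs_seq[]; rewrite size_mkseq => /mkseq_agree /nP + _.
      by rewrite metric_sym.
  have [d xd] := infty_ptP x; subst x.
  have [k ke] := natSinv_lt _ e20.
  apply: (local (ext_nbhs t (tail d k))) => //.
  - by apply: open_ext_nbhs; exact: open_tail.
  - split; last first.
      by exists (\val (infty_pt d)); [exact: ext_entry_fin_size|exact: tail_infty].
    by move=> i lt_i; rewrite /= -cats1 onth_cat size_map lt_i.
  move=> b /ext_nbhs_seq[bt]; have [d' [n bn]] := dnP (b (size t)).
  rewrite bn => -[/= d'd /(_ n erefl) le_kn].
  have [_ htP] := hP t; apply: lt_trans ke.
  apply: lt_le_trans (le_natSinv _ _ le_kn).
  by apply: htP; rewrite mkseqS bt bn d'd.
move=> r [t rt]; have [Ht _] := hP t.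
by rewrite (_ : (fun d => _) = h t)//; apply/funext => d; rewrite rt.
Qed.

(* [dec] plays the role of a bijection from N to [D] x N: it turns sequences
   indexed by [D] x N into sequences indexed by N. *)
Definition vertex_ball (dec : nat -> D * nat) (h : D -> X) (k : nat) : set X :=
  [set y | mdist (h (dec k).1) y < (dec k).2.+1%:R^-1].

Definition approx_dihypergraph (dec : nat -> D * nat) : set (nat -> X) :=
  [set g | exists h, H h /\ forall k, vertex_ball dec h k (g k)].

(** Serves to identify limits of approximations; restricting to [m] above [n] allows discarding an
    index at which two approximations differ. *)
Lemma mdist_eq (x y : X) (n : nat) :
  (forall m, (n < m)%N -> mdist x y < m.+1%:R^-1 + m.+1%:R^-1) -> x = y.
Proof.
move=> xy; apply: mdist_positivity; apply/eqP; rewrite eq_le mdist_ge0 andbT.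
rewrite leNgt; apply/negP => xy0.
have [m me] := natSinv_lt _ (divr_gt0 xy0 (ltr0n R 2)).
have := xy _ (leq_maxl n.+1 m); apply/negP; rewrite -leNgt.
by rewrite [leRHS]splitr lerD// (le_trans (le_natSinv _ _ (leq_maxr n.+1 m)))// ltW.
Qed.

Section coded.
Variables (enc : D * nat -> nat) (dec : nat -> D * nat).
Hypothesis encK : cancel enc dec.
Local Notation G := (approx_dihypergraph dec).

Lemma is_dihypergraph_approx : is_dihypergraph H -> is_dihypergraph G.
Proof.
move=> hH x [h [Hh hx]]; apply: (hH x); suff <- : h = fun=> x by [].
apply/funext => d; apply: (mdist_eq _ _ 0) => m _.
have := hx (enc (d, m)); rewrite /vertex_ball encK /= => /lt_trans; apply.
by rewrite ltrDl invr_gt0 ltr0n.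
Qed.

Lemma box_open_approx : box_open G.
Proof.
exists [set B | exists h, H h /\ B = box (vertex_ball dec h)].
  move=> _ [h [_ ->]]; apply: (finI_from1 id).
  by exists (vertex_ball dec h) => // k; exact: open_mdist_lt.
apply/seteqP; split=> [g [_ [h [Hh ->]] gh]|g [h [Hh gh]]]; first by exists h.
by exists (box (vertex_ball dec h)) => //; exists h.
Qed.

(** The closures of the color classes of [G] cover [X]. An edge of [H] inside one closure could be
    approximated, in each of its vertex balls, by points of that class, giving a monochromatic edge
    of [G]. *)
Lemma coloring_of_approx :
  chromatic_le_aleph0 G -> has_delta02_aleph0_coloring H.
Proof.
move=> [K [c [/countable_injP[e einj] cG]]].
apply: (@closed_cover_coloring R X D H
  (fun n => closure [set x | e (c x) = n])).
- by move=> n; exact: closed_closure.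
- by move=> x; exists (e (c x)); exact: subset_closure.
move=> n h Hh hcl.
have /choice[g gP] : forall k, exists y,
    e (c y) = n /\ vertex_ball dec h k y.
  move=> k; have hU : nbhs (h (dec k).1) (vertex_ball dec h k).
    apply: open_nbhs_nbhs; split; first exact: open_mdist_lt.
    by rewrite /vertex_ball /= mdistxx invr_gt0 ltr0n.
  by have [y [/= ? ?]] := hcl (dec k).1 _ hU; exists y.
apply: (cG g); first by exists h; split=> // k; have [] := gP k.
exists (c (g 0%N)) => k; apply: einj; rewrite ?inE//.
by have [-> _] := gP k; have [-> _] := gP 0%N.
Qed.

(** Infinite sequences are coded letter by letter and sent through [f]. The edge for [t] is read off
    from one fixed choice of extensions; it serves all others because changing a single extension
    leaves the limits unchanged. *)
Lemma homomorphism_of_approx (d0 : D) :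
  has_continuous_homomorphism H_baire G ->
  has_continuous_homomorphism (H_infty (D:=D)) H.
Proof.
move=> [f cf fG].
(* The default [0] is never reached, since letters have a finite second coordinate. *)
pose code (s : S) := enc ((\val s).1, odflt 0%N (\val s).2).
apply: (homomorphism_extension d0 (fun b => f (code \o b))).
  move=> b e e0.
  have : nbhs (code \o b : baire_space)
      (f @^-1` [set y | mdist (f (code \o b)) y < e]).
    apply: cf; apply: open_nbhs_nbhs; split; first exact: open_mdist_lt.
    by rewrite /= mdistxx.
  move=> /agree_filter_cvg[n _ nP]; exists n => b' bb'; apply: nP => i lt_i /=.
  by rewrite bb'.
move=> t.
pose z k : baire_space := fun i => nth 0%N (rcons (map code t) k) i.
have cz k : cylinder (rcons (map code t) k) (z k) by [].
have [h [Hh hz]] : G (fun k => f (z k)).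
  by apply: fG; exists (map code t).
exists h; split=> // d n b bt.
(* Puts the given [b] at the index of [(d, n)], so that its value is controlled by the edge [h']. *)
pose z' k := if k == enc (d, n) then code \o b : baire_space else z k.
have cz' k : cylinder (rcons (map code t) k) (z' k).
  rewrite /z'; case: eqP => // -> i lt_i /=.
  have -> : rcons (map code t) (enc (d, n)) = mkseq (code \o b) (size t).+1.
    by rewrite [RHS](map_comp code b) -/(mkseq b _) bt map_rcons.
  by rewrite nth_mkseq//; move: lt_i; rewrite size_rcons size_map.
have [h' [Hh' hz']] : G (fun k => f (z' k)).
  by apply: fG; exists (map code t).
(* [z] and [z'] differ at one index only, so they have the same limits. *)
have -> : h d = h' d.
  apply: (mdist_eq _ _ n) => m lt_nm.
  have := hz' (enc (d, m)); have := hz (enc (d, m)); rewrite /vertex_ball !encK /= /z'.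
  case: eqP => [/(can_inj encK)[mn]|_]; first by rewrite mn ltnn in lt_nm.
  move=> hm h'm; apply: le_lt_trans (metric_triangle _ (f (z (enc (d, m)))) _) _.
  by rewrite ltrD// metric_sym.
by have := hz' (enc (d, n)); rewrite /vertex_ball encK /= /z' eqxx metric_sym.
Qed.

End coded.
End homomorphism.

(** * Coding of the index set by natural numbers, and the dichotomy *)

Lemma countable_coding (D : Type) (d0 : D) : countable [set: D] ->
  exists (enc : D * nat -> nat) (dec : nat -> D * nat), cancel enc dec.
Proof.
move=> /countable_injP[e einj].
pose enc (p : D * nat) := pickle (e p.1, p.2).
have enc_inj : injective enc.
  move=> [d n] [d' n'] /(pcan_inj pickleK)[/einj dd' ->].
  by rewrite dd'// inE.
exists enc.
have /choice[dec decP] : forall k, exists p, forall q, enc q = k -> p = q.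
  move=> k; have [[q qk]|nq] := pselect (exists q, enc q = k).
    by exists q => q' q'k; apply: enc_inj; rewrite qk.
  (* Numbers outside the range of [enc] decode to this default pair. *)
  by exists (d0, 0%N) => q qk; case: nq; exists q.
by exists dec => p; exact: decP.
Qed.

Theorem theorem4p4 (Gamma : topologicalType -> Prop) (hGamma : OGDN Gamma)
    (D : discreteTopologicalType) (hD : countable [set: D])
    (hD2 : exists d0 d1 : D, d0 <> d1)
    (R : realType) (X : metricType R) (hX : Gamma X)
    (H : set (D -> X)) (hH : is_dihypergraph H) :
  (has_delta02_aleph0_coloring H \/
     has_continuous_homomorphism (H_infty (D:=D)) H) /\
  ~ (has_delta02_aleph0_coloring H /\
     has_continuous_homomorphism (H_infty (D:=D)) H).
Proof.
have [d0 _] := hD2; split; last exact: coloring_homomorphism_exclusive.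
have [enc [dec encK]] := countable_coding D d0 hD.
have dG := is_dihypergraph_approx H enc dec encK hH.
have [cG|fG] := hGamma X hX _ dG (box_open_approx H dec).
  by left; exact: coloring_of_approx cG.
by right; exact: homomorphism_of_approx encK d0 fG.
Qed.
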